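(* Let $k$ be a nonzero integer with $3\nmid v_2(k)$. Then each of the following cubic Thue equations has no integer solution $(x,y)\in\mathbb{Z}^2$: \begin{enumerate} \item $mx^3-nx^2y-(n+3m)xy^2-my^3=k$, for all $m,n\in\mathbb{Z}$ with $m$ odd and $\gcd(m,n)=1$; \item $x^3-(n^3-2n^2+3n-3)x^2y-n^2xy^2-y^3=k$, for all $n\in\mathbb{Z}$ with $n\not\equiv 1 \pmod 4$; \item $x^3-n(n^2+n+3)(n^2+2)x^2y-(n^3+2n^2+3n+3)xy^2-y^3=k$, for all $n\in\mathbb{Z}$; \item $x^3+(n^7+2n^6+3n^5-n^4-3n^3-3n^2+3n+3)x^2y+(-n^4+3n)xy^2-y^3=k$, for all $n\in\mathbb{Z}$. \end{enumerate}
   Context: For a nonzero integer $k$, $v_2(k)$ denotes the $2$-adic valuation of $k$, i.e. the exponent of the largest power of $2$ dividing $k$. *)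

(* Defs.v *)
From mathcomp Require Import all_boot all_order all_algebra.

Set Implicit Arguments.
Unset Strict Implicit.
Unset Printing Implicit Defensive.

(* The 2-adic valuation of a nonzero integer; the junk value at 0 is 0. *)
Definition v2 (k : int) : nat := logn 2 (absz k).

(* Main.v *)
(** If x and y are coprime, the value at (x, y) of each of these cubic forms is
    odd or exactly divisible by 8; the second case can only occur when x and y
    are both odd, and is seen in the coordinates x = s + t, y = s - t.  Taking
    the gcd of x and y out multiplies the value by a cube, so the 2-adic
    valuation of every nonzero value is a multiple of 3. *)
Require Import Defs.
From mathcomp Require Import all_boot all_order all_algebra.
From mathcomp Require Import zify ring.

Set Implicit Arguments.
Unset Strict Implicit.
Unset Printing Implicit Defensive.

Import Order.TTheory GRing.Theory Num.Theory.
Local Open Scope ring_scope.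

(** The common shape of the four forms: the outer coefficients are opposite, so they cancel at (1,
    1), leaving [b + c]. *)
Definition cubic (a b c x y : int) : int :=
  a * x ^+ 3 + b * x ^+ 2 * y + c * x * y ^+ 2 - a * y ^+ 3.

Lemma cubicZ a b c d x y :
  cubic a b c (d * x) (d * y) = d ^+ 3 * cubic a b c x y.
Proof. by rewrite /cubic; ring. Qed.

Lemma v2M (x y : int) : x != 0 -> y != 0 -> v2 (x * y) = (v2 x + v2 y)%N.
Proof. by move=> x0 y0; rewrite /v2 abszM lognM // absz_gt0. Qed.

Lemma v2X (x : int) n : v2 (x ^+ n) = (n * v2 x)%N.
Proof. by rewrite /v2 abszX lognX. Qed.

Lemma v2_odd (x : int) : ~~ (2 %| x)%Z -> v2 x = 0%N.
Proof.
move=> x_odd; rewrite /v2 lognE /=.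
by move: x_odd; rewrite dvdzE /= => /negbTE ->; rewrite andbF.
Qed.

Lemma dvdz2N (x : int) : (2 %| - x)%Z = (2 %| x)%Z.
Proof. by lia. Qed.

Lemma dvdz2D (x y : int) : (2 %| x + y)%Z = ((2 %| x)%Z == (2 %| y)%Z).
Proof. by apply/idP/eqP; lia. Qed.

Lemma dvdz2M (x y : int) : (2 %| x * y)%Z = (2 %| x)%Z || (2 %| y)%Z.
Proof. by rewrite !dvdzE abszM Euclid_dvdM. Qed.

Lemma dvdz2X (x : int) n : (2 %| x ^+ n.+1)%Z = (2 %| x)%Z.
Proof. by rewrite !dvdzE abszX Euclid_dvdX // andbT. Qed.

Definition dvdz2E := (dvdz2N, dvdz2D, dvdz2M, dvdz2X).

Lemma oddz_ex (n : int) : ~~ (2 %| n)%Z -> exists j, n = 2 * j + 1.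
Proof. by exists (n %/ 2)%Z; lia. Qed.

Lemma modz4_3_ex (n : int) :
  ~~ (2 %| n)%Z -> (n != 1 %[mod 4])%Z -> exists j, n = 4 * j + 3.
Proof. by exists (n %/ 4)%Z; lia. Qed.

Lemma v2_cubic_of_coprime (a b c : int) :
  (forall x y, coprimez x y -> (3 %| v2 (cubic a b c x y))%N) ->
  forall x y, cubic a b c x y != 0 -> (3 %| v2 (cubic a b c x y))%N.
Proof.
move=> H x y F0.
have d0 : gcdz x y != 0.
  apply: contraNneq F0 => /eqP; rewrite gcdz_eq0 => /andP[/eqP-> /eqP->].
  by rewrite /cubic; apply/eqP; ring.
pose u := (x %/ gcdz x y)%Z; pose v := (y %/ gcdz x y)%Z.
have Ex : x = gcdz x y * u by rewrite mulrC divzK // dvdz_gcdl.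
have Ey : y = gcdz x y * v by rewrite mulrC divzK // dvdz_gcdr.
have uv : coprimez u v.
  apply/eqP/(mulfI d0); rewrite mulr1.
  by have := mulz_gcdr (gcdz x y) u v; rewrite -Ex -Ey.
have EF : cubic a b c x y = gcdz x y ^+ 3 * cubic a b c u v.
  by rewrite -cubicZ -Ex -Ey.
move: F0; rewrite EF mulf_eq0 negb_or => /andP[d3 F0].
by rewrite v2M // v2X dvdn_addr ?dvdn_mulr ?H.
Qed.

Lemma coprimez_odd (x y : int) : coprimez x y -> (2 %| x)%Z -> ~~ (2 %| y)%Z.
Proof.
move=> xy x2; apply/negP => y2.
by have := dvdz_gcd 2 x y; rewrite x2 y2 (eqP xy).
Qed.

(** For coprime arguments the value is odd: if just one of [x], [y] is odd, only its cube term is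
    odd; if both are, the value is congruent to [b + c] modulo 2. *)
Lemma v2_cubic_odd (a b c : int) : ~~ (2 %| a)%Z -> ~~ (2 %| b + c)%Z ->
  forall x y, cubic a b c x y != 0 -> (3 %| v2 (cubic a b c x y))%N.
Proof.
move=> a1 bc1; apply: v2_cubic_of_coprime => x y /coprimez_odd xy.
rewrite v2_odd //; move: xy a1 bc1; rewrite /cubic !dvdz2E.
by case: (2 %| x)%Z; case: (2 %| y)%Z; case: (2 %| a)%Z; case: (2 %| b)%Z;
  case: (2 %| c)%Z => // /(_ isT).
Qed.

(** The two equations say that the form takes the values [8 * p] at (1, 1) and [8 * q] at (1, -1).
    These are the coefficients of s^3 and t^3 after substituting x = s + t, y = s - t, and the mixed
    coefficients are multiples of 8 too. *)
Lemma v2_cubic_8 (a b c p q : int) : ~~ (2 %| a)%Z ->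
  ~~ (2 %| p)%Z -> ~~ (2 %| q)%Z -> b + c = 8 * p -> c - b + 2 * a = 8 * q ->
  forall x y, cubic a b c x y != 0 -> (3 %| v2 (cubic a b c x y))%N.
Proof.
move=> a1 p1 q1 bc bca; apply: v2_cubic_of_coprime => x y /coprimez_odd xy.
have [/andP[x1 y1]|xy1] := boolP (~~ (2 %| x)%Z && ~~ (2 %| y)%Z); last first.
  rewrite v2_odd //; move: xy a1 xy1; rewrite /cubic !dvdz2E.
  rewrite ?orbT; case: (2 %| x)%Z; case: (2 %| y)%Z; rewrite ?orbT //=;
    case: (2 %| a)%Z => // xy; by have := xy isT.
have [s xs] : exists s, x + y = 2 * s by exists ((x + y) %/ 2)%Z; lia.
(* Here [x - s] plays the role of t. *)
have -> : cubic a b c x y =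
    2 ^+ 3 * (p * s ^+ 3 + (a - q) * s ^+ 2 * (x - s)
              - p * s * (x - s) ^+ 2 + q * (x - s) ^+ 3).
  have -> : y = 2 * s - x by rewrite -xs; ring.
  have -> : c = 4 * (p + q) - a by lia.
  have -> : b = 4 * (p - q) + a by lia.
  by rewrite /cubic; ring.
set e := (X in 2 ^+ 3 * X).
(* As s + t = x is odd, exactly one of s, t is odd; the mixed terms are even and [e] has the parity
   of [p] or of [q]. *)
have e1 : ~~ (2 %| e)%Z.
  rewrite /e !dvdz2E (negbTE x1) (negbTE p1) (negbTE q1) (negbTE a1).
  by case: (2 %| s)%Z.
by rewrite v2M // ?v2X ?(v2_odd e1) //; apply: contraNneq e1 => ->.
Qed.

Lemma no_solution (k : int) (a b c : int) : k != 0 -> ~~ (3 %| v2 k)%N ->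
  (forall x y, cubic a b c x y != 0 -> (3 %| v2 (cubic a b c x y))%N) ->
  forall x y, cubic a b c x y <> k.
Proof. by move=> k0 /negP v2k H x y Fk; apply: v2k; rewrite -Fk H ?Fk. Qed.

Theorem corollary1 (k : int) (hk : k != 0) (hv : ~~ (3 %| v2 k)%N) :
  [/\ (forall m n : int, ~~ (2 %| m)%Z -> coprimez m n ->
         ~ exists x y : int,
           m * x ^+ 3 - n * x ^+ 2 * y - (n + 3 * m) * x * y ^+ 2
             - m * y ^+ 3 = k),
      (forall n : int, (n != 1 %[mod 4])%Z ->
         ~ exists x y : int,
           x ^+ 3 - (n ^+ 3 - 2 * n ^+ 2 + 3 * n - 3) * x ^+ 2 * y
             - n ^+ 2 * x * y ^+ 2 - y ^+ 3 = k),
      (forall n : int,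
         ~ exists x y : int,
           x ^+ 3 - n * (n ^+ 2 + n + 3) * (n ^+ 2 + 2) * x ^+ 2 * y
             - (n ^+ 3 + 2 * n ^+ 2 + 3 * n + 3) * x * y ^+ 2 - y ^+ 3 = k)
    & (forall n : int,
         ~ exists x y : int,
           x ^+ 3
             + (n ^+ 7 + 2 * n ^+ 6 + 3 * n ^+ 5 - n ^+ 4 - 3 * n ^+ 3
                  - 3 * n ^+ 2 + 3 * n + 3) * x ^+ 2 * y
             + (- n ^+ 4 + 3 * n) * x * y ^+ 2 - y ^+ 3 = k)].
Proof.
have solve a b c := @no_solution k a b c hk hv.
split=> [m n m1 _|n n1|n|n] [x [y Fk]].
- apply: (@solve m (- n) (- (n + 3 * m)) _ x y); last by rewrite -Fk /cubic; ring.
  (* Here b + c = -(2n + 3m). *)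
  by apply: v2_cubic_odd => //; rewrite !dvdz2E (negbTE m1); case: (2 %| n)%Z.
- apply: (@solve 1 (- (n ^+ 3 - 2 * n ^+ 2 + 3 * n - 3)) (- n ^+ 2) _ x y);
    last by rewrite -Fk /cubic; ring.
  have [n2|n2] := boolP (2 %| n)%Z.
    by apply: v2_cubic_odd => //; rewrite !dvdz2E n2.
  have [j ->] := modz4_3_ex n2 n1.
  (* The witnesses come from b + c = -(n - 1)(n^2 + 3) and c - b + 2 = (n - 1)^3, where n - 1 = 2(2j
     + 1) is exactly divisible by 2. *)
  apply: (@v2_cubic_8 _ _ _ (- (2 * j + 1) * (4 * j ^+ 2 + 6 * j + 3))
    ((2 * j + 1) ^+ 3)) => //; try ring; by rewrite !dvdz2E; case: (2 %| j)%Z.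
- apply: (@solve 1 (- (n * (n ^+ 2 + n + 3) * (n ^+ 2 + 2)))
    (- (n ^+ 3 + 2 * n ^+ 2 + 3 * n + 3)) _ x y); last by rewrite -Fk /cubic; ring.
  have [n2|n2] := boolP (2 %| n)%Z.
    by apply: v2_cubic_odd => //; rewrite !dvdz2E n2.
  have [j ->] := oddz_ex n2.
  (* With n = 2j + 1, the witnesses come from b + c = -(n^2 + 3)(n^3 + n^2 + 3n + 1), whose factors
     are divisible by 4 and 2, and c - b + 2 = (n^2 + 1)(n^3 + n^2 + 3n - 1), whose factors are
     divisible by 2 and 4. *)
  apply: (@v2_cubic_8 _ _ _
    (- (j ^+ 2 + j + 1) * (4 * j ^+ 3 + 8 * j ^+ 2 + 8 * j + 3))
    ((2 * j ^+ 2 + 2 * j + 1) * (2 * j ^+ 3 + 4 * j ^+ 2 + 4 * j + 1))) => //;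
    try ring; by rewrite !dvdz2E; case: (2 %| j)%Z.
- apply: (@solve 1 (n ^+ 7 + 2 * n ^+ 6 + 3 * n ^+ 5 - n ^+ 4 - 3 * n ^+ 3
    - 3 * n ^+ 2 + 3 * n + 3) (- n ^+ 4 + 3 * n) _ x y);
    last by rewrite -Fk /cubic; ring.
  (* Here b + c is odd for both parities of n, so no factor 8 arises. *)
  by apply: v2_cubic_odd => //; rewrite !dvdz2E; case: (2 %| n)%Z.
Qed.
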